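(* For every nonempty set $\mathcal{D}$ of discounting functions, the validity problem for $\mathrm{LTL}^{\mathrm{disc}\oplus}[\mathcal{D}]$ is undecidable: there is no algorithm that, given an $\mathrm{LTL}^{\mathrm{disc}\oplus}[\mathcal{D}]$ formula $\varphi$ over atomic propositions $AP$ and a threshold $v\in[0,1]$, decides whether $[\![\pi,\varphi]\!]>v$ for every computation $\pi\in(2^{AP})^\omega$.
   Context: Let $AP$ be a finite set of atomic propositions. A computation is $\pi=\pi_0\pi_1\cdots\in(2^{AP})^\omega$, $\pi^i=\pi_i\pi_{i+1}\cdots$. A discounting function is a strictly decreasing $\eta:\mathbb{N}\to[0,1]$ with $\lim_{i\to\infty}\eta(i)=0$. For a set $\mathcal{D}$ of discounting functions, $\mathrm{LTL}^{\mathrm{disc}\oplus}[\mathcal{D}]$ formulas are given by $\varphi ::= \mathtt{True}\mid p\mid\neg\varphi\mid\varphi\vee\varphi\mid\mathsf{X}\varphi\mid\varphi\,\mathsf{U}\,\varphi\mid\varphi\,\mathsf{U}_\eta\,\varphi\mid\varphi\oplus\varphi$ ($p\in AP$, $\eta\in\mathcal{D}$), with values $[\![\pi,\varphi]\!]\in[0,1]$: $[\![\pi,\mathtt{True}]\!]=1$; $[\![\pi,p]\!]=1$ if $p\in\pi_0$, else $0$; $[\![\pi,\neg\varphi]\!]=1-[\![\pi,\varphi]\!]$; $[\![\pi,\varphi\vee\psi]\!]=\max\{[\![\pi,\varphi]\!],[\![\pi,\psi]\!]\}$; $[\![\pi,\mathsf{X}\varphi]\!]=[\![\pi^1,\varphi]\!]$;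 $[\![\pi,\varphi\,\mathsf{U}\,\psi]\!]=\sup_{i\ge0}\min\{[\![\pi^i,\psi]\!],\min_{0\le j<i}[\![\pi^j,\varphi]\!]\}$; $[\![\pi,\varphi\,\mathsf{U}_\eta\,\psi]\!]=\sup_{i\ge0}\min\{\eta(i)[\![\pi^i,\psi]\!],\min_{0\le j<i}\eta(j)[\![\pi^j,\varphi]\!]\}$; $[\![\pi,\varphi\oplus\psi]\!]=\frac{[\![\pi,\varphi]\!]+[\![\pi,\psi]\!]}{2}$. *)

(* Defs.v *)
From mathcomp Require Import all_boot all_order all_algebra.
From mathcomp Require Import boolp classical_sets reals.
Set Implicit Arguments. Unset Strict Implicit. Unset Printing Implicit Defensive.
Import Order.TTheory GRing.Theory Num.Theory.
Local Open Scope ring_scope.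

Inductive prf : Type :=
| PZero : prf
| PSucc : prf
| PProj : nat -> prf
| PComp : prf -> list prf -> prf
| PRec  : prf -> prf -> prf
| PMu   : prf -> prf.

Inductive prf_eval : prf -> seq nat -> nat -> Prop :=
| ev_zero v : prf_eval PZero v 0
| ev_succ x v : prf_eval PSucc (x :: v) x.+1
| ev_proj i v : (i < size v)%N -> prf_eval (PProj i) v (nth 0%N v i)
| ev_comp f gs v w y :
    prf_evals gs v w -> prf_eval f w y -> prf_eval (PComp f gs) v y
| ev_rec0 f g v y : prf_eval f v y -> prf_eval (PRec f g) (0%N :: v) y
| ev_recS f g n v y z :
    prf_eval (PRec f g) (n :: v) y -> prf_eval g (n :: y :: v) z ->
    prf_eval (PRec f g) (n.+1 :: v) z
| ev_mu f v n :
    prf_eval f (n :: v) 0 ->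
    (forall m, (m < n)%N -> exists k, prf_eval f (m :: v) k.+1) ->
    prf_eval (PMu f) v n
with prf_evals : list prf -> seq nat -> seq nat -> Prop :=
| evs_nil v : prf_evals nil v [::]
| evs_cons g gs v y ys :
    prf_eval g v y -> prf_evals gs v ys -> prf_evals (g :: gs) v (y :: ys).

Definition decidable_nat (P : nat -> Prop) : Prop :=
  exists c : prf, forall n,
    (P n -> prf_eval c [:: n] 1%N) /\ (~ P n -> prf_eval c [:: n] 0%N).

Definition npair (a b : nat) : nat := ((a + b) * (a + b).+1)./2 + b.

(* Atomic propositions are named by naturals; discounting functions
   occurring in formulas are named by naturals [k], interpreted through
   a naming [e : nat -> (nat -> R)] whose values all lie in D. *)
Inductive form : Type :=
| FTrue : form
| FAtom : nat -> form
| FNot  : form -> form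
| FOr   : form -> form -> form
| FNext : form -> form
| FUntil : form -> form -> form
| FDUntil : nat -> form -> form -> form
| FAvg  : form -> form -> form.

Fixpoint enc_form (f : form) : nat :=
  match f with
  | FTrue => npair 0 0
  | FAtom p => npair 1 p
  | FNot f => npair 2 (enc_form f)
  | FOr f g => npair 3 (npair (enc_form f) (enc_form g))
  | FNext f => npair 4 (enc_form f)
  | FUntil f g => npair 5 (npair (enc_form f) (enc_form g))
  | FDUntil k f g => npair 6 (npair k (npair (enc_form f) (enc_form g)))
  | FAvg f g => npair 7 (npair (enc_form f) (enc_form g))
  end.

Section Semantics.
Variable R : realType.

Definition discounting (eta : nat -> R) : Prop :=
  (forall i, 0 <= eta i <= 1) /\
  (forall i j, (i < j)%N -> eta j < eta i) /\
  (forall eps : R, 0 < eps -> exists N, forall i, (N <= i)%N -> `|eta i| < eps).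

(* A computation is pi : nat -> (nat -> bool); pi t p means p \in pi_t.
   [val e pi phi t] is [[pi^t, phi]]. *)
Fixpoint val (e : nat -> nat -> R) (pi : nat -> nat -> bool) (phi : form)
  : nat -> R :=
  match phi with
  | FTrue => fun _ => 1
  | FAtom p => fun t => if pi t p then 1 else 0
  | FNot f => let vf := val e pi f in fun t => 1 - vf t
  | FOr f g => let vf := val e pi f in let vg := val e pi g in
               fun t => Num.max (vf t) (vg t)
  | FNext f => let vf := val e pi f in fun t => vf t.+1
  | FUntil f g => let vf := val e pi f in let vg := val e pi g in
      fun t => sup (range (fun i : nat =>
        Num.min (vg (t + i)%N) (\big[Num.min/1]_(j < i) vf (t + j)%N)))
  | FDUntil k f g => let vf := val e pi f in let vg := val e pi g in
      let eta := e k in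
      fun t => sup (range (fun i : nat =>
        Num.min (eta i * vg (t + i)%N)
                (\big[Num.min/1]_(j < i) (eta j * vf (t + j)%N))))
  | FAvg f g => let vf := val e pi f in let vg := val e pi g in
      fun t => (vf t + vg t) / 2
  end.

Definition valid_above (e : nat -> nat -> R) (phi : form) (v : R) : Prop :=
  forall pi : nat -> nat -> bool, v < val e pi phi 0.

Definition validity_problem (e : nat -> nat -> R) (n : nat) : Prop :=
  exists phi p q, n = npair (enc_form phi) (npair p q) /\
    (0 < q)%N /\ (p <= q)%N /\ valid_above e phi (p%:R / q%:R).

End Semantics.

(* Main.v *)
(** Reduction from the halting of counter machines.  A computation encodes a run
    by marking the start of each configuration and recording the content [x] of
    a register as the distance from that mark to the next position carrying the
    atom of the register.  There the formula [True U_eta p] has the value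
    [eta x], and [eta] is injective, so two contents are equal iff the averages
    [a + not b] and [not a + b] do not exceed 1/2.  Hence a formula [rejects]
    exceeds 1/2 at every computation except the encodings of accepting runs.

    Neither a universal machine nor a computable compiler is needed for the
    undecidability: from a decider one gets a recursive [d] that, on the code of
    a formula [A], decides the validity of [A \/ "the input is not the code of
    A"]; compile [d] into a machine and run it on the code of the formula
    [rejects] of that same machine. *)
Require Import Defs.
From mathcomp Require Import all_boot all_order all_algebra.
From mathcomp Require Import boolp classical_sets reals.
From mathcomp Require Import zify lra.

Set Implicit Arguments.
Unset Strict Implicit.
Unset Printing Implicit Defensive.

(** * Compiling recursive functions to loop programs *)

Definition store := nat -> nat.
Definition upd (s : store) r x : store := fun q => if q == r then x else s q.

Ltac store_ext := apply/funext => q; rewrite /upd /=;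
  repeat (case: (eqVneq _ _) => ?; subst => /=); try lia; try congruence.

Lemma map_upd s r x args : r \notin args -> map (upd s r x) args = map s args.
Proof.
move=> h; apply/eq_in_map => q qa; rewrite /upd; case: eqVneq => // e.
by rewrite -e qa in h.
Qed.

Inductive cmd : Type :=
| Skip : cmd
| Inc : nat -> cmd
| Seq : cmd -> cmd -> cmd
| Loop : nat -> cmd -> cmd.

(** [Loop r c] is a while loop that decrements [r] before each pass, which makes its test a single
    [DEC] of the machine. As [exec] is a relation, a diverging program simply has no final store. *)
Inductive exec : cmd -> store -> store -> Prop :=
| exec_skip s : exec Skip s s
| exec_inc r s : exec (Inc r) s (upd s r (s r).+1)
| exec_seq c1 c2 s1 s2 s3 :
    exec c1 s1 s2 -> exec c2 s2 s3 -> exec (Seq c1 c2) s1 s3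
| exec_loop0 r c s : s r = 0 -> exec (Loop r c) s s
| exec_loopS r c s1 s2 s3 : s1 r <> 0 ->
    exec c (upd s1 r (s1 r).-1) s2 -> exec (Loop r c) s2 s3 ->
    exec (Loop r c) s1 s3.

Lemma exec_eq c s s1 s2 : exec c s s1 -> s1 = s2 -> exec c s s2.
Proof. by move=> h <-. Qed.

Definition clear r := Loop r Skip.
Definition move a b := Loop a (Inc b).
Definition copy a b t := Seq (Loop a (Seq (Inc b) (Inc t))) (move t a).

Lemma exec_clear r s : exec (clear r) s (upd s r 0).
Proof.
move e : (s r) => n; elim: n s e => [|n IH] s e.
  by apply: exec_eq (exec_loop0 _ e) _; store_ext.
apply: exec_loopS (exec_skip _) _; first by rewrite e.
by apply: exec_eq (IH _ _) _; [rewrite /upd eqxx e | store_ext].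
Qed.

Lemma exec_move a b s : a != b ->
  exec (move a b) s (upd (upd s a 0) b (s b + s a)).
Proof.
move=> ab; move e : (s a) => n; elim: n s e => [|n IH] s e.
  by apply: exec_eq (exec_loop0 _ e) _; store_ext.
apply: exec_loopS (exec_inc _ _) _; first by rewrite e.
apply: exec_eq (IH _ _) _; rewrite /upd !eqxx ?(negPf ab) ?e //.
by rewrite eq_sym (negPf ab) addnS; store_ext.
Qed.

Lemma exec_copy a b t s : a != b -> a != t -> b != t -> s t = 0 ->
  exec (copy a b t) s (upd s b (s b + s a)).
Proof.
move=> ab at' bt st0.
apply: (@exec_seq _ _ _ (upd (upd (upd s a 0) b (s b + s a)) t (s t + s a))).
  (* The passes make [t] nonzero, so the induction has to run over stores with arbitrary content of
     [t]. *)
  clear st0; move e : (s a) => n; elim: n s e => [|n IH] s e.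
    by apply: exec_eq (exec_loop0 _ e) _; store_ext.
  apply: exec_loopS (exec_seq (exec_inc _ _) (exec_inc _ _)) _; first by rewrite e.
  have ba : b == a = false by rewrite eq_sym (negPf ab).
  have ta : t == a = false by rewrite eq_sym (negPf at').
  have tb : t == b = false by rewrite eq_sym (negPf bt).
  apply: exec_eq (IH _ _) _; rewrite /upd !eqxx ?(negPf ab) ?(negPf at') ?e //.
  by rewrite ta tb ba (negPf bt) !addnS; store_ext.
have ta : t != a by rewrite eq_sym.
apply: exec_eq (exec_move _ ta) _.
have tb : t == b = false by rewrite eq_sym (negPf bt).
by rewrite /upd !eqxx (negPf ab) (negPf at'); store_ext.
Qed.

Definition clears := foldr (fun r c => Seq (clear r) c) Skip.

Lemma exec_clears rs s :
  exec (clears rs) s (fun q => if q \in rs then 0 else s q).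
Proof.
elim: rs s => [|r rs IH] s /=.
  by apply: exec_eq (exec_skip _) _.
apply: exec_seq (exec_clear _ _) _.
apply: exec_eq (IH _) _; apply/funext => q; rewrite inE /upd.
by case: (q \in rs); rewrite ?orbT ?orbF.
Qed.

(* [fr] is the first free register: all registers from [fr] on hold 0, both
   before and after the execution. *)
Fixpoint comp (c : prf) (args : seq nat) (dst fr : nat) : cmd :=
  match c with
  | PZero => Skip
  | PSucc => Seq (copy (head 0 args) dst fr) (Inc dst)
  | PProj i => copy (nth 0 args i) dst fr
  | PComp f gs =>
      let hi := fr + size gs in
      Seq ((fix go gs j := match gs with
                           | [::] => Skip
                           | g :: gs => Seq (comp g args j hi) (go gs j.+1)
                           end) gs fr)
          (Seq (comp f (iota fr (size gs)) dst hi) (clears (iota fr (size gs))))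
  | PRec f g =>
      let v := behead args in
      Seq (copy (head 0 args) fr.+2 fr.+3)
     (Seq (comp f v fr.+1 fr.+4)
     (Seq (Loop fr.+2 (Seq (comp g [:: fr, fr.+1 & v] fr.+3 fr.+4)
                      (Seq (clear fr.+1) (Seq (move fr.+3 fr.+1) (Inc fr)))))
     (Seq (move fr.+1 dst) (clear fr))))
  | PMu f =>
      Seq (comp f (fr :: args) fr.+1 fr.+2)
     (Seq (Loop fr.+1 (Seq (clear fr.+1)
                      (Seq (Inc fr) (comp f (fr :: args) fr.+1 fr.+2))))
          (move fr dst))
  end.

(** The nested [fix] of [comp] as a function of its own, open to induction on the list. *)
Fixpoint comps (gs : seq prf) args hi j :=
  if gs is g :: gs then Seq (comp g args j hi) (comps gs args hi j.+1) else Skip.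

Lemma comp_PComp f gs args dst fr : comp (PComp f gs) args dst fr =
  Seq (comps gs args (fr + size gs) fr)
    (Seq (comp f (iota fr (size gs)) dst (fr + size gs))
         (clears (iota fr (size gs)))).
Proof.
rewrite /=; congr Seq.
by move: (fr + _) => hi; elim: gs (fr) => [|g gs IH] j //=; rewrite IH.
Qed.

(** The generated principle gives no induction hypothesis for the functions in the list of a
    [PComp]. *)
Lemma prf_list_ind (P : prf -> Prop) :
  P PZero -> P PSucc -> (forall i, P (PProj i)) ->
  (forall f gs, P f -> foldr (fun g Q => P g /\ Q) True gs -> P (PComp f gs)) ->
  (forall f g, P f -> P g -> P (PRec f g)) ->
  (forall f, P f -> P (PMu f)) -> forall c, P c.
Proof.
move=> h0 hS hP hC hR hM; fix IH 1; case=> [||i|f gs|f g|f].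
- exact: h0.
- exact: hS.
- exact: hP.
- apply: hC; first exact: IH.
  by elim: gs => [|g gs ih]; [|split; [exact: IH|exact: ih]].
- by apply: hR; exact: IH.
- by apply: hM; exact: IH.
Qed.

(** Since [move] and [copy] add to their target, [dst] must start at 0. The final store differs from
    [s] at [dst] only, so arguments survive and scratch registers are 0 again. Only terminating
    evaluations matter, as a decider is total. *)
Definition comp_correct c := forall args dst fr s y,
  all (fun r => r < fr) args -> dst < fr -> dst \notin args ->
  (forall r, fr <= r -> s r = 0) -> s dst = 0 ->
  prf_eval c (map s args) y -> exec (comp c args dst fr) s (upd s dst y).

Lemma fresh_notin fr r args : all (fun r => r < fr) args -> fr <= r -> r \notin args.
Proof.
move=> /allP h le; apply/negP => /h /=; lia.
Qed.

Lemma all_ltW fr fr' (args : seq nat) : fr <= fr' ->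
  all (fun r => r < fr) args -> all (fun r => r < fr') args.
Proof. by move=> le; apply: sub_all => r /= ?; lia. Qed.

(** All scratch space starts at [hi], above the result slots, so later components do not disturb
    earlier results. *)
Lemma comps_correct gs : foldr (fun g Q => comp_correct g /\ Q) True gs ->
  forall args fr hi j s ys,
  all (fun r => r < fr) args -> fr <= j -> j + size gs <= hi ->
  (forall r, j <= r -> s r = 0) ->
  prf_evals gs (map s args) ys ->
  exec (comps gs args hi j) s
    (fun r => if j <= r < j + size ys then nth 0 ys (r - j) else s r)
  /\ size ys = size gs.
Proof.
elim: gs => [|g gs IH] /= => [_|[hg hgs]] args fr hi j s ys ha frj jhi s0 ev.
  inversion ev; subst; split=> //; apply: exec_eq (exec_skip _) _.
  by apply/funext => r /=; case: ifP => //; lia.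
inversion ev as [|? ? ? y zs evg evgs]; subst.
have jn : j \notin args by exact: fresh_notin ha frj.
have s0' r : j.+1 <= r -> upd s j y r = 0.
  by move=> lr; rewrite /upd; case: eqP => [|_]; [lia|apply: s0; lia].
have evgs' : prf_evals gs (map (upd s j y) args) zs by rewrite map_upd.
have [|||ex sz] := IH hgs args fr hi j.+1 _ zs _ _ _ s0' evgs'; try lia; try done.
split; last by rewrite /= sz.
apply: exec_seq.
  apply: (hg) evg => //; [apply: all_ltW ha; lia | lia | move=> r ?; apply: s0; lia| exact: s0].
apply: exec_eq ex _; apply/funext => r /=; rewrite /upd.
case: (eqVneq r j) => [->|rj].
  by rewrite ltnn subnn /=; case: ifP => //; lia.
case: ifP => h1; case: ifP => h2 //; try lia.
by rewrite (_ : r - j = (r - j.+1).+1) //; lia.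
Qed.

Lemma comp_PComp_correct f gs : comp_correct f ->
  foldr (fun g Q => comp_correct g /\ Q) True gs -> comp_correct (PComp f gs).
Proof.
move=> hf hgs args dst fr s y ha hd hda s0 sd ev; rewrite comp_PComp.
inversion ev as [| | |? ? ? w ? evs evf| | |]; subst.
have [||ex sz] := @comps_correct gs hgs args fr (fr + size gs) fr s w ha _ _ s0 evs; try lia.
apply: exec_seq ex _.
set s1 := (fun r => _).
have s1d : s1 dst = 0 by rewrite /s1 ifF //; lia.
have e : map s1 (iota fr (size gs)) = w.
  apply: (@eq_from_nth _ 0); first by rewrite size_map size_iota.
  move=> i; rewrite size_map size_iota => li.
  rewrite (nth_map 0) ?size_iota // nth_iota // /s1 ifT; last lia.
  by congr nth; lia.
apply: (@exec_seq _ _ _ (upd s1 dst y)).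
  apply: hf => //.
  - by apply/allP => r; rewrite mem_iota => /andP[].
  - lia.
  - by rewrite mem_iota; lia.
  - by move=> r lr; rewrite /s1 ifF; [apply: s0; lia|lia].
  - by rewrite e.
apply: exec_eq (exec_clears _ _) _; apply/funext => r; rewrite mem_iota /upd /s1.
case: (eqVneq r dst) => [->|rd]; first by rewrite ifF //; lia.
case: ifP => [h|h]; first by rewrite s0 //; lia.
by rewrite ifF //; lia.
Qed.

Lemma nthlt (args : seq nat) fr dst i : all (fun r => r < fr) args -> dst \notin args ->
  i < size args -> nth 0 args i < fr /\ nth 0 args i != dst.
Proof.
move=> ha hd li; have m := mem_nth 0 li; split; first exact: (allP ha).
by apply: contraNneq hd => <-.
Qed.

Lemma comp_PRec_correct f g : comp_correct f -> comp_correct g ->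
  comp_correct (PRec f g).
Proof.
move=> hf hg [|a v] dst fr s y; first by move=> _ _ _ _ _ ev; inversion ev.
move=> ha hd hda s0 sd ev /=.
have hv : all (fun r => r < fr) v by move: ha => /= /andP[].
have [la ad] : a < fr /\ a != dst by exact: (@nthlt (a :: v) fr dst 0).
(* Register [fr] counts the finished rounds, [fr.+1] holds the current value and [fr.+2] the number
   of remaining rounds. *)
pose st i z k : store := upd (upd (upd s fr i) fr.+1 z) fr.+2 k.
have mapst i z k : map (st i z k) v = map s v.
  by rewrite /st !map_upd //; apply: (fresh_notin hv); lia.
have stf i z k : st i z k fr = i by rewrite /st /upd; repeat case: eqP => //; lia.
have stz i z k : st i z k fr.+1 = z by rewrite /st /upd; repeat case: eqP => //; lia.
set W := Loop _ _.
(* The loop is followed backwards: an execution from a late round is extended to one from round 0.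
   So the induction peels off the last round, as [ev_recS] does. *)
have [x [evx ex]] : exists x, prf_eval f (map s v) x /\
    forall k s', exec W (st (s a) y k) s' -> exec W (st 0 x (k + s a)) s'.
  move: ev => /=; move: (s a) => n; elim: n y => [|n IH] y ev.
    inversion ev; subst; exists y; split=> // k s'.
    by rewrite addn0.
  inversion ev as [| | | | |? ? ? ? z ? ev1 ev2|]; subst.
  have [x [evx ex]] := IH _ ev1; exists x; split=> // k s' ex'.
  rewrite -addSnnS; apply: ex; apply: (@exec_loopS _ _ _ (st n.+1 y k)); last by [].
    by rewrite /st /upd eqxx.
  apply: (@exec_seq _ _ _ (upd (st n z k) fr.+3 y)).
    rewrite (_ : upd _ _ _ = st n z k); last first.
      by rewrite /st; store_ext.
    apply: hg.
    - rewrite /= (all_ltW _ hv) ?andbT; lia.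
    - lia.
    - rewrite !inE !negb_or (fresh_notin hv) ?andbT; lia.
    - by move=> r lr; rewrite /st /upd !ifF ?s0 //; lia.
    - by rewrite /st /upd !ifF ?s0 //; lia.
    - by rewrite /= mapst stf stz.
  apply: exec_seq (exec_clear _ _) _.
  apply: exec_seq.
    by apply: exec_move; lia.
  apply: exec_eq (exec_inc _ _) _.
  rewrite /st; apply/funext => q; rewrite /upd.
  have s3 := s0 fr.+3 (leq_trans (leqnSn _) (leq_trans (leqnSn _) (leqnSn _))).
  by repeat (case: (eqVneq _ _) => ?; subst => /=); try lia.
apply: (@exec_seq _ _ _ (upd s fr.+2 (s a))).
  apply: exec_eq (exec_copy _ _ _ _) _; try lia; first by apply: s0; lia.
  by rewrite s0 //; lia.
apply: (@exec_seq _ _ _ (st 0 x (0 + s a))).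
  apply: exec_eq (hf _ _ _ _ x _ _ _ _ _ _) _.
  - apply: all_ltW hv; lia.
  - lia.
  - apply: (fresh_notin hv); lia.
  - by move=> r lr; rewrite /upd ifF ?s0 //; lia.
  - by rewrite /upd ifF ?s0 //; lia.
  - by rewrite map_upd //; apply: (fresh_notin hv); lia.
  - rewrite /st; have sf := s0 fr (leqnn _); store_ext.
apply: exec_seq.
  by apply: ex; apply: exec_loop0; rewrite /st /upd eqxx.
apply: exec_seq.
  by apply: exec_move; lia.
apply: exec_eq (exec_clear _ _) _.
rewrite /st.
have s1 := s0 fr (leqnn _); have s2 := s0 fr.+1 (leqnSn _).
have s3 : s fr.+2 = 0 by apply: s0; lia.
store_ext.
Qed.

Lemma comp_PMu_correct f : comp_correct f -> comp_correct (PMu f).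
Proof.
move=> hf args dst fr s y ha hd hda s0 sd ev /=.
inversion ev as [| | | | | |? ? ? ev0 evS]; subst.
pose st i z : store := upd (upd s fr i) fr.+1 z.
have mapst i z : map (st i z) args = map s args.
  by rewrite /st !map_upd //; apply: (fresh_notin ha); lia.
set F := comp f _ _ _.
have exF i z : prf_eval f (i :: map s args) z -> exec F (st i 0) (st i z).
  move=> e; apply: exec_eq (hf _ _ _ _ z _ _ _ _ _ _) _.
  - rewrite /= (all_ltW _ ha) ?andbT; lia.
  - lia.
  - rewrite inE negb_or (fresh_notin ha) ?andbT; lia.
  - by move=> r lr; rewrite /st /upd !ifF ?s0 //; lia.
  - by rewrite /st /upd eqxx.
  - by rewrite /= mapst /st /upd eqxx ifF //; lia.
  - rewrite /st; store_ext.
have s1 := s0 fr (leqnn _); have s2 := s0 fr.+1 (leqnSn _).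
set W := Loop _ _.
(* [k] counts the candidates between [i] and the least zero [y]; the loop register [fr.+1] holds the
   value at [i], so it is 0 exactly when [k] is. The decrement made by the loop is harmless because
   the body first clears this register. *)
have exW k : forall i z, i + k = y -> prf_eval f (i :: map s args) z ->
    (z = 0 <-> k = 0) -> exec W (st i z) (st y 0).
  elim: k => [|k IH] i z ik e zk.
    rewrite (proj2 zk erefl); rewrite addn0 in ik; rewrite ik.
    by apply: exec_loop0; rewrite /st /upd eqxx.
  have [z' [ez' zk']] : exists z, prf_eval f (i.+1 :: map s args) z /\
      (z = 0 <-> k = 0).
    case: (k) ik => [|k'] ik; first by exists 0; rewrite (_ : i.+1 = y) //; lia.
    have [|z' ez'] := evS i.+1; first lia.
    by exists z'.+1.
  apply: exec_loopS; last (apply: (IH i.+1 z') => //; lia).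
    by rewrite /st /upd eqxx => /(proj1 zk).
  apply: exec_seq (exec_clear _ _) _.
  apply: exec_seq (exec_inc _ _) _.
  rewrite [X in exec _ X](_ : _ = st i.+1 0); first exact: exF.
  by rewrite /st; store_ext.
have [z [ez zk]] : exists z, prf_eval f (0 :: map s args) z /\ (z = 0 <-> y = 0).
  case: (y) ev0 evS => [|y'] ev0 evS; first by exists 0.
  by have [|z ez] := evS 0 => //; exists z.+1.
apply: (@exec_seq _ _ _ (st 0 z)).
  rewrite [X in exec _ X](_ : _ = st 0 0); first exact: exF.
  by rewrite /st; store_ext.
apply: exec_seq (exW _ _ _ _ ez zk) _ => //.
apply: exec_eq (exec_move _ _) _; first lia.
by rewrite /st; store_ext.
Qed.

Theorem compP c : comp_correct c.
Proof.
elim/prf_list_ind: c => [||i|f gs|f g|f].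
- move=> args dst fr s y ha hd hda s0 sd ev; inversion ev; subst.
  by apply: exec_eq (exec_skip _) _; store_ext.
- move=> [|a v] dst fr s y ha hd hda s0 sd ev; inversion ev; subst.
  have [la ad] := @nthlt (a :: v) fr dst 0 ha hda isT.
  rewrite /= in la ad.
  apply: exec_seq; first by apply: (@exec_copy a dst fr s) => //; [lia|lia|exact: s0].
  by apply: exec_eq (exec_inc _ _) _; store_ext.
- move=> args dst fr s y ha hd hda s0 sd ev; inversion ev as [| |? ? li| | | |]; subst.
  rewrite size_map in li; have [la ad] := nthlt ha hda li.
  apply: exec_eq (exec_copy _ _ _ (s0 _ (leqnn _))) _ => //; try lia.
  by rewrite (nth_map 0) // sd.
- exact: comp_PComp_correct.
- exact: comp_PRec_correct.
- exact: comp_PMu_correct.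
Qed.

(** * Counter machines *)

Inductive instr : Type :=
| INC : nat -> instr
| DEC : nat -> nat -> nat -> instr.

(** A machine halts by leaving the program; from then on its configuration repeats forever. *)
Definition step (P : seq instr) (cf : nat * store) : nat * store :=
  let: (pc, s) := cf in
  match onth P pc with
  | None => cf
  | Some (INC r) => (pc.+1, upd s r (s r).+1)
  | Some (DEC r j k) => if s r == 0 then (k, s) else (j, upd s r (s r).-1)
  end.

Fixpoint len c := match c with
  | Skip => 0
  | Inc _ => 1
  | Seq c1 c2 => len c1 + len c2
  | Loop _ c => (len c).+2
  end.

(** There is no unconditional jump, and jumping is tied to a decrement; so the test of a loop is
    repeated at its end instead of jumping back to its head. *)
Fixpoint code c i : seq instr := match c with
  | Skip => [::]
  | Inc r => [:: INC r]
  | Seq c1 c2 => code c1 i ++ code c2 (i + len c1)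
  | Loop r c => DEC r i.+1 (i + (len c).+2) ::
      rcons (code c i.+1) (DEC r i.+1 (i + (len c).+2))
  end.

Lemma size_code c i : size (code c i) = len c.
Proof.
elim: c i => [|r|c1 h1 c2 h2|r c h] i //=; first by rewrite size_cat h1 h2.
by rewrite size_rcons h.
Qed.

Lemma onth_mid (A B : seq instr) x : onth (A ++ x :: B) (size A) = Some x.
Proof. by elim: A => //=. Qed.

Lemma onth_loop_tail A c r B :
  onth (A ++ code (Loop r c) (size A) ++ B) (size A + len c).+1 =
  Some (DEC r (size A).+1 (size A + (len c).+2)).
Proof.
set x := DEC _ _ _.
rewrite (_ : A ++ _ = (A ++ x :: code c (size A).+1) ++ x :: B).
  by rewrite -[RHS](onth_mid (A ++ x :: code c (size A).+1) B) size_cat /= size_code addnS.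
by rewrite /= -/x -cats1 -!catA.
Qed.

Lemma exec_code c s s' : exec c s s' -> forall P A B,
  P = A ++ code c (size A) ++ B ->
  exists k, iter k (step P) (size A, s) = (size A + len c, s').
Proof.
(* After a pass the machine stands at the second copy of the loop test, so the induction also needs
   the claim for executions that start there. *)
have main : exec c s s' ->
  (forall P A B, P = A ++ code c (size A) ++ B ->
   exists k, iter k (step P) (size A, s) = (size A + len c, s')) /\
  (forall r b, c = Loop r b -> forall P A B, P = A ++ code c (size A) ++ B ->
   exists k, iter k (step P) ((size A + len b).+1, s) = (size A + len c, s')).
  elim=> {c s s'}.
  - by move=> s; split=> // P A B _; exists 0; rewrite /= addn0.
  - move=> r s; split=> // P A B ->; exists 1.
    by rewrite /= onth_mid addn1.
  - move=> c1 c2 s1 s2 s3 _ [h1 _] _ [h2 _]; split=> // P A B e.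
    have [|k1 e1] := h1 P A (code c2 (size A + len c1) ++ B).
      by rewrite e /= -!catA.
    have [|k2 e2] := h2 P (A ++ code c1 (size A)) B.
      by rewrite e size_cat size_code /= -!catA.
    exists (k2 + k1); rewrite iterD e1.
    by move: e2; rewrite size_cat size_code /= addnA.
  - move=> r c s sr; split=> [P A B|r' b [_ <-] P A B] ->; exists 1.
      by rewrite /= onth_mid sr.
    by rewrite /=; have /= -> := onth_loop_tail A c r B; rewrite sr.
  - move=> r c s1 s2 s3 sr _ [h1 _] _ [_ h2].
    have h P A B : P = A ++ code (Loop r c) (size A) ++ B ->
        exists k, iter k (step P) ((size A).+1, upd s1 r (s1 r).-1) =
                  (size A + len (Loop r c), s3).
      move=> e; have [k2 e2] := h2 r c erefl P A B e.
      have [|k1 e1] := h1 P (rcons A (DEC r (size A).+1 (size A + (len c).+2)))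
        (DEC r (size A).+1 (size A + (len c).+2) :: B).
        by rewrite e /= size_rcons -!cats1 -!catA.
      exists (k2 + k1); rewrite iterD.
      by move: e1; rewrite size_rcons addSn => ->.
    have sr' : s1 r == 0 = false by apply/eqP.
    split=> [P A B e|r' b [_ <-] P A B e]; have [k ek] := h P A B e;
      exists k.+1; rewrite iterSr -ek; congr iter.
      by rewrite e /= onth_mid sr'.
    by rewrite e /=; have /= -> := onth_loop_tail A c r B; rewrite sr'.
by move=> /main [].
Qed.

Definition init m : store := upd (fun=> 0) 0 m.
Definition run P m k := iter k (step P) (0, init m).
(* Register 0 holds the input, register 1 the output. *)
Definition accepts P m := exists k, (run P m k).1 = size P /\ (run P m k).2 1 <> 0.
Definition prog d := code (comp d [:: 0] 1 2) 0.

Lemma run_halted P m k j : (run P m k).1 = size P -> k <= j -> run P m j = run P m k.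
Proof.
move=> h /subnK <-; elim: (j - k) => [//|i IH].
rewrite addSn {1}/run iterS -/(run P m _) IH; case: (run P m k) h => pc s /= ->.
by rewrite onth_default.
Qed.

(** The evaluation yields one halting time; a halted run stays put, so every halting time shows the
    same output [y]. *)
Lemma accepts_prog d m y : prf_eval d [:: m] y -> accepts (prog d) m <-> y <> 0.
Proof.
move=> ev; have ex : exec (comp d [:: 0] 1 2) (init m) (upd (init m) 1 y).
  by apply: compP => // -[|[|r]].
have [|k ek] := exec_code ex (P := prog d) (A := [::]) (B := [::]).
  by rewrite cats0.
have rk : run (prog d) m k = (size (prog d), upd (init m) 1 y).
  by rewrite /run ek /prog size_code.
split=> [[j [hj1 hj2]]|y0]; last by exists k; rewrite rk.
have e : run (prog d) m j = run (prog d) m k.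
  by case: (leqP j k) => le; [rewrite (run_halted hj1 le)|apply: run_halted; rewrite ?rk ?(ltnW le)].
by move: hj2; rewrite e rk.
Qed.

(** A step raises a register by at most one. The bound will fix the distance between marks. *)
Lemma run_bound P m k r : (run P m k).2 r <= m + k.
Proof.
elim: k r => [|k IH] r; first by rewrite /run /= /init /upd; case: eqP; lia.
rewrite /run iterS -/(run P m k).
case: (run P m k) IH => pc s /= IH; case: onth => [[q|q j l]|] /=.
- by rewrite /upd; case: eqP => _; have := IH q; have := IH r; lia.
- case: eqP => _ /=; first by have := IH r; lia.
  by rewrite /upd; case: eqP => _; have := IH q; have := IH r; lia.
- by have := IH r; lia.
Qed.

(** * Coding formulas *)

Definition tri n := (n * n.+1)./2.

Lemma triS n : tri n.+1 = n.+1 + tri n.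
Proof.
by rewrite /tri (_ : n.+1 * n.+2 = n.+1.*2 + n * n.+1) ?halfD ?odd_double ?doubleK // -muln2; lia.
Qed.

Lemma npairE a b : npair a b = tri (a + b) + b. Proof. by []. Qed.

(** Cantor pairing: [npair a b] is entry [b] of diagonal [a + b], and all entries of a diagonal lie
    below the start of the next one. *)
Lemma npair_inj a b a' b' : npair a b = npair a' b' -> a = a' /\ b = b'.
Proof.
have le s t b1 : s < t -> b1 <= s -> tri s + b1 < tri t.
  move=> /subnKC <- lb; elim: (t - s.+1) => [|n IH]; first by rewrite addn0 triS; lia.
  by rewrite addnS triS; lia.
rewrite !npairE => e; have [h|h|h] := ltngtP (a + b) (a' + b'); last by rewrite h in e; lia.
  by have := le _ _ b h (leq_addl _ _); lia.
by have := le _ _ b' h (leq_addl _ _); lia.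
Qed.

Lemma enc_form_inj : injective enc_form.
Proof.
elim=> [|p|f hf|f hf g hg|f hf|f hf g hg|k f hf g hg|f hf g hg];
  case=> [|p'|f'|f' g'|f'|f' g'|k' f' g'|f' g'] /npair_inj [] // _.
- by move=> ->.
- by move=> /hf ->.
- by case/npair_inj => /hf -> /hg ->.
- by move=> /hf ->.
- by case/npair_inj => /hf -> /hg ->.
- by case/npair_inj => -> /npair_inj [/hf -> /hg ->].
- by case/npair_inj => /hf -> /hg ->.
Qed.

(** * Recursive functions that compute codes of formulas *)

Lemma prf_comp1 f g v x y : prf_eval g v x -> prf_eval f [:: x] y ->
  prf_eval (PComp f [:: g]) v y.
Proof. by move=> h; apply: ev_comp; do !constructor. Qed.

Lemma prf_comp2 f g h v x y z : prf_eval g v x -> prf_eval h v y ->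
  prf_eval f [:: x; y] z -> prf_eval (PComp f [:: g; h]) v z.
Proof. by move=> ? ?; apply: ev_comp; do !constructor. Qed.

Fixpoint prf_const n := if n is n.+1 then PComp PSucc [:: prf_const n] else PZero.

Lemma prf_constP n v : prf_eval (prf_const n) v n.
Proof. by elim: n => [|n IH] /=; [constructor | apply: prf_comp1 IH _; constructor]. Qed.

Definition prf_add := PRec (PProj 0) (PComp PSucc [:: PProj 1]).

Lemma prf_addP a b : prf_eval prf_add [:: a; b] (a + b).
Proof.
elim: a => [|a IH]; first by apply: ev_rec0; exact: (@ev_proj 0 [:: b]).
apply: ev_recS IH _; apply: prf_comp1 (ev_succ _ _).
exact: (@ev_proj 1 [:: a; a + b; b]).
Qed.

Definition prf_tri :=
  PRec PZero (PComp prf_add [:: PComp PSucc [:: PProj 0]; PProj 1]).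

Lemma prf_triP n : prf_eval prf_tri [:: n] (tri n).
Proof.
elim: n => [|n IH]; first by apply: ev_rec0; constructor.
apply: ev_recS IH _; rewrite triS; apply: prf_comp2 (prf_addP _ _).
  by apply: prf_comp1 (ev_succ _ _); exact: (@ev_proj 0 [:: n; tri n]).
exact: (@ev_proj 1 [:: n; tri n]).
Qed.

Definition prf_npair :=
  PComp prf_add [:: PComp prf_tri [:: prf_add]; PProj 1].

Lemma prf_npairP a b : prf_eval prf_npair [:: a; b] (npair a b).
Proof.
apply: prf_comp2 (prf_addP _ _); last exact: (@ev_proj 1 [:: a; b]).
exact: prf_comp1 (prf_addP _ _) (prf_triP _).
Qed.

Definition prf_pair f g := PComp prf_npair [:: f; g].

Lemma prf_pairP f g v a b : prf_eval f v a -> prf_eval g v b ->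
  prf_eval (prf_pair f g) v (npair a b).
Proof. by move=> hf hg; exact: prf_comp2 hf hg (prf_npairP _ _). Qed.

(* Holds where the next occurrence of [p] is not exactly [m] positions away. *)
Fixpoint first_not p m := match m with
  | 0 => FNot (FAtom p)
  | m.+1 => FOr (FAtom p) (FNext (first_not p m))
  end.

(** The only family of formulas whose codes are computed from the input; 3 and 4 are the tags of
    [FOr] and [FNext]. *)
Definition prf_first_not p :=
  PRec (prf_const (enc_form (first_not p 0)))
    (prf_pair (prf_const 3) (prf_pair (prf_const (enc_form (FAtom p)))
      (prf_pair (prf_const 4) (PProj 1)))).

Lemma prf_first_notP p m :
  prf_eval (prf_first_not p) [:: m] (enc_form (first_not p m)).
Proof.
elim: m => [|m IH]; first by apply: ev_rec0; exact: prf_constP.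
apply: ev_recS IH _.
do 3! (apply: prf_pairP; first exact: prf_constP).
exact: (@ev_proj 1 [:: m; _]).
Qed.

Import Order.TTheory GRing.Theory Num.Theory.
Local Open Scope ring_scope.

(** * Formulas describing runs *)
Section SupRange.
Variable R : realType.
Implicit Types (f : nat -> R) (x : R).

Lemma sup_range_max f i0 : (forall i, f i <= f i0) -> sup (range f) = f i0.
Proof.
move=> h; apply/le_anti/andP; split.
  by apply: ge_sup => [|_ [i _ <-]]; [exists (f i0), i0|exact: h].
by apply: ub_le_sup; [exists (f i0) => _ [i _ <-]; exact: h|exists i0].
Qed.

Lemma lt_sup_range f x : (forall i, f i <= 1) ->
  x < sup (range f) <-> exists i, x < f i.
Proof.
move=> h; split=> [xs|[i xi]].
  have [|_ [i _ <-] xi] := sup_gt _ xs; first by exists (f 0%N), 0%N.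
  by exists i.
apply: lt_le_trans xi _; apply: ub_le_sup; last by exists i.
by exists 1 => _ [j _ <-].
Qed.

Lemma sup_range01 f : (forall i, 0 <= f i <= 1) -> 0 <= sup (range f) <= 1.
Proof.
move=> h; have /andP[f0 f1] := h 0%N; apply/andP; split.
  apply: le_trans f0 _; apply: ub_le_sup; last by exists 0%N.
  by exists 1 => _ [j _ <-]; have /andP[] := h j.
apply: ge_sup => [|_ [i _ <-]]; first by exists (f 0%N), 0%N.
by have /andP[] := h i.
Qed.

End SupRange.

(** * Formulas that detect errors in an encoded run *)

Definition FAnd a b := FNot (FOr (FNot a) (FNot b)).
Definition FFalse := FNot FTrue.
Definition FEv a := FUntil FTrue a.
Definition ors := foldr FOr FFalse.
Definition differ a b := FOr (FAvg a (FNot b)) (FAvg (FNot a) b).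

(* Atom 0 marks the positions where a configuration starts, atom [2 (i + 1)]
   stands for the control state [i]; the value of register [r] is the distance
   to the next position that carries atom [2 r + 1]. *)
Definition mark := FAtom 0.
Definition state i := FAtom i.+1.*2.
Definition reg r := FAtom r.*2.+1.
Definition value r := FDUntil 0 FTrue (reg r).
Definition at_next a := FNext (FUntil (FNot mark) (FAnd mark a)).

Definition first (pi : nat -> nat -> bool) p t x :=
  pi (t + x)%N p /\ forall j, (j < x)%N -> ~~ pi (t + j)%N p.

Definition next_mark (pi : nat -> nat -> bool) t t' :=
  [/\ (t < t')%N, pi t' 0%N & forall u, (t < u < t')%N -> ~~ pi u 0%N].

Inductive change := Keep | Up | Down.
Definition change_val o x :=
  match o with Keep => x | Up => x.+1 | Down => x.-1 end.
Definition change_at r o (q : nat) := if q == r then o else Keep.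

(* An increment is tested by looking one position later at the next mark, since
   the value of the discounted until can be shifted in that direction only. *)
Definition bad_change o r := match o with
  | Keep => differ (value r) (at_next (value r))
  | Up => FOr (at_next (reg r)) (differ (value r) (at_next (FNext (value r))))
  | Down => differ (FNext (value r)) (at_next (value r))
  end.

Definition bad_trans B j f :=
  FOr (FNot (at_next (state j))) (ors [seq bad_change (f r) r | r <- iota 0 B]).

(** Content 0 means that the atom of the register sits on the mark itself, so [reg r] serves as the
    zero test. Outside the program the configuration must repeat, as under [step]. *)
Definition bad_step B P i := match onth P i with
  | None => bad_trans B i (fun=> Keep)
  | Some (INC r) => bad_trans B i.+1 (change_at r Up)
  | Some (DEC r j k) =>
      FOr (FAnd (reg r) (bad_trans B k (fun=> Keep)))
          (FAnd (FNot (reg r)) (bad_trans B j (change_at r Down)))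
  end.

Lemma all_onth (T : Type) (a : pred T) s i x : all a s -> onth s i = Some x -> a x.
Proof. by elim: s i => [|y s IH] [|i] //= /andP[ay /IH h]; [case=> <-|exact: h]. Qed.

(** A mark may carry several state atoms. The last disjunct keeps the final state from appearing
    beside another one, so a run cannot pretend to have halted. *)
Definition bad_at B P i := FAnd mark (FAnd (state i)
  (FOr (bad_step B P i) (if i == size P then FFalse else state (size P)))).

(** Register 0 is left open: the input enters only through the separate disjunct [first_not 1 m], so
    this formula and its code do not depend on the input. *)
Definition rejects B P := ors
  [:: FNot mark; FNot (state 0);
      ors [seq FNot (reg r) | r <- iota 1 B.-1];
      FEv (ors [seq bad_at B P i | i <- iota 0 B.+1]);
      FNot (FEv (FAnd mark (FAnd (state (size P)) (FNot (reg 1)))))].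

(** [B] bounds all registers, including the output register 1, and all control states, so that the
    finite disjunctions of [rejects] cover every configuration. *)
Definition wf B P := [&& (1 < B)%N, (size P <= B)%N &
  all (fun x => match x with
                | INC r => (r < B)%N
                | DEC r j k => [&& (r < B)%N, (j <= B)%N & (k <= B)%N]
                end) P].

Lemma wf_exists P : exists B, wf B P.
Proof.
rewrite /wf; elim: P => [|x P [B /and3P[B1 sP aP]]]; first by exists 2%N.
pose y := match x with INC r => r | DEC r j k => (r + j + k)%N end.
exists (B + y).+1; apply/and3P; split; [lia | rewrite /=; lia | ].
apply/andP; split; first by rewrite /y; case: (x) => [r|r j k]; rewrite ?ltnS; lia.
by apply: sub_all aP => -[r|r j k] => [|/and3P[]]; lia.
Qed.

(** * Values of the formulas at a fixed computation *)

Section Semantics.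
Variables (R : realType) (e : nat -> nat -> R).
Hypothesis he : forall k, discounting (e k).
Variable pi : nat -> nat -> bool.
Local Notation val := (Defs.val e pi).

Lemma val01 a t : 0 <= val a t <= 1.
Proof.
have big01 n (F : 'I_n -> R) : (forall j, 0 <= F j <= 1) ->
    0 <= \big[Num.min/1]_(j < n) F j <= 1.
  move=> h; apply/andP; split; last exact: bigmin_le_id.
  by apply: le_bigmin => // j _; have /andP[] := h j.
have min01 (x y : R) : 0 <= x <= 1 -> 0 <= y <= 1 -> 0 <= Num.min x y <= 1.
  by move=> hx hy; case: (leP x y).
have mul01 (x y : R) : 0 <= x <= 1 -> 0 <= y <= 1 -> 0 <= x * y <= 1.
  by move=> /andP[? ?] /andP[? ?]; rewrite mulr_ge0 //= mulr_ile1.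
elim: a t => [|p|a ha|a ha b hb|a ha|a ha b hb|k a ha b hb|a ha b hb] t /=.
- by rewrite ler01 lexx.
- by case: (pi t p); rewrite ?ler01 ?lexx.
- by have := ha t; lra.
- by case: (leP (Defs.val e pi a t) (Defs.val e pi b t)).
- exact: ha.
- by apply: sup_range01 => i; apply: min01 => //; apply: big01.
- have [ek _] := he k.
  apply: sup_range01 => i; apply: min01; first exact: mul01.
  by apply: big01 => j; exact: mul01.
- by have := ha t; have := hb t; lra.
Qed.

Lemma val_le1 a t : val a t <= 1. Proof. by have /andP[] := val01 a t. Qed.
Lemma val_ge0 a t : 0 <= val a t. Proof. by have /andP[] := val01 a t. Qed.

Lemma val_and a b t : val (FAnd a b) t = Num.min (val a t) (val b t).
Proof.
rewrite /=; move: (Defs.val e pi a t) (Defs.val e pi b t) => x y.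
by case: (leP x y); case: (leP (1 - x) (1 - y)); lra.
Qed.

Lemma val_atom p t : val (FAtom p) t = (pi t p)%:R.
Proof. by rewrite /=; case: (pi t p). Qed.

(** Exceeding 1/2 commutes with [FOr], [FAnd] and [FEv] whatever the values are. It does not commute
    with [FNot] at the value 1/2, so negation is read this way only on formulas with values 0 and
    1. *)
Definition tr a t : bool := 2^-1 < val a t.

Lemma tr_or a b t : tr (FOr a b) t = tr a t || tr b t.
Proof. by rewrite /tr /= lt_max. Qed.

Lemma tr_and a b t : tr (FAnd a b) t = tr a t && tr b t.
Proof. by rewrite /tr val_and lt_min. Qed.

Lemma tr_false t : tr FFalse t = false.
Proof. by rewrite /tr /= subrr; apply/negbTE; rewrite -leNgt invr_ge0. Qed.

Lemma tr_ors l t : tr (ors l) t = has (fun a => tr a t) l.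
Proof. by elim: l => [|a l IH] /=; rewrite ?tr_false // tr_or IH. Qed.

Lemma half_lt (b : bool) : ((2^-1 : R) < b%:R) = b.
Proof. by case: b; [rewrite invf_lt1 ?ltr1n|rewrite ltNge invr_ge0 ler0n]. Qed.

Lemma half_ltN (b : bool) : ((2^-1 : R) < 1 - b%:R) = ~~ b.
Proof. by rewrite -(half_lt (~~ b)); case: b; rewrite ?subrr ?subr0. Qed.

Lemma tr_atom p t : tr (FAtom p) t = pi t p.
Proof. by rewrite /tr val_atom half_lt. Qed.

Lemma tr_natom p t : tr (FNot (FAtom p)) t = ~~ pi t p.
Proof. by rewrite /tr -half_ltN -val_atom. Qed.

Lemma bigmin1 n : \big[Num.min/1]_(j < n) (1 : R) = 1.
Proof. by apply: bigmin_eq_id. Qed.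

Lemma tr_ev a t : tr (FEv a) t <-> exists i, tr a (t + i).
Proof.
rewrite /tr /= lt_sup_range => [|i]; last by rewrite ge_min val_le1.
by split=> -[i h]; exists i; move: h; rewrite bigmin1 (min_idPl (val_le1 _ _)).
Qed.

Lemma tr_nev a t : (forall u, val a u = 0 \/ val a u = 1) ->
  tr (FNot (FEv a)) t <-> ~ exists i, tr a (t + i).
Proof.
move=> h; have tr0 u : tr a u <-> val a u = 1.
  rewrite /tr; case: (h u) => ->; last by rewrite (half_lt true).
  by rewrite (half_lt false); split=> // /eqP; rewrite eq_sym oner_eq0.
have fE : (fun i : nat => Num.min (val a (t + i)) (\big[Num.min/1]_(j < i) 1)) =
    fun i => val a (t + i).
  by apply/funext => i; rewrite bigmin1 (min_idPl (val_le1 _ _)).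
rewrite {1}/tr /= fE; have [[i hi]|nex] := pselect (exists i, tr a (t + i)).
  rewrite (sup_range_max (i0 := i)) => [|j].
    by rewrite (tr0 _).1 // (half_ltN true); split=> // -[]; exists i.
  by rewrite (proj1 (tr0 _) hi) val_le1.
have v0 i : val a (t + i) = 0.
  by case: (h (t + i)%N) => // /(tr0 _).2 hi; case: nex; exists i.
rewrite (sup_range_max (i0 := 0%N)) => [|j]; last by rewrite !v0.
by rewrite v0 (half_ltN false).
Qed.

(** For values [x] and [y] the two averages are [1/2 + (x - y)/2] and [1/2 + (y - x)/2]. *)
Lemma tr_differ a b t : tr (differ a b) t = (val a t != val b t).
Proof.
rewrite tr_or /tr /=; move: (val a t) (val b t) => x y.
by apply/idP/idP => [/orP h|h]; [apply/eqP => xy; case: h; lra|]; lra.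
Qed.

(** The supremum is attained at the next mark: earlier indices have value 0 on the right of the
    until, later ones meet [FNot mark] with value 0 at this mark. *)
Lemma val_at_next a t t' : next_mark pi t t' -> val (at_next a) t = val a t'.
Proof.
move=> [tt' m' h]; pose i0 := (t' - t.+1)%N.
have ti0 : (t.+1 + i0)%N = t' by rewrite /i0; lia.
rewrite /at_next.
have vE u : val (FAnd mark a) u = if pi u 0%N then val a u else 0.
  rewrite val_and val_atom; case: (pi u 0%N).
    by rewrite (min_idPr (val_le1 _ _)).
  by rewrite (min_idPl (val_ge0 _ _)).
have fE : val (FNext (FUntil (FNot mark) (FAnd mark a))) t =
  sup (range (fun i : nat => Num.min (val (FAnd mark a) (t.+1 + i))
   (\big[Num.min/1]_(j < i) (1 - val mark (t.+1 + j))))) by [].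
have v0 : Num.min (val (FAnd mark a) (t.+1 + i0))
   (\big[Num.min/1]_(j < i0) (1 - val mark (t.+1 + j))) = val a t'.
  rewrite vE ti0 m' bigmin_eq_id ?(min_idPl (val_le1 _ _)) // => j _.
  rewrite val_atom (negPf (h _ _)) ?subr0 //; have := ltn_ord j; rewrite /i0; lia.
rewrite fE (sup_range_max (i0 := i0)) // v0 => i.
rewrite ge_min vE; have [lt|gt|->] := ltngtP i i0.
- rewrite (negPf (h _ _)) ?val_ge0 //; lia.
- apply/orP; right; apply: le_trans (bigmin_le _ (Ordinal gt) _) _.
  by rewrite val_atom /= ti0 m' subrr val_ge0.
- by rewrite ti0 m' lexx.
Qed.

Lemma e_gt0 i : 0 < e 0 i.
Proof.
have [h1 [h2 _]] := he 0; apply: le_lt_trans (h2 i i.+1 (ltnSn _)).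
by have /andP[] := h1 i.+1.
Qed.

Lemma e_le i j : (i <= j)%N -> e 0 j <= e 0 i.
Proof.
by have [_ [h2 _]] := he 0; rewrite leq_eqVlt => /predU1P[->//|/h2/ltW].
Qed.

Lemma e_inj : injective (e 0).
Proof.
have [_ [h2 _]] := he 0; move=> i j eij.
by have [/h2|/h2|//] := ltngtP i j; rewrite eij ltxx.
Qed.

(** Among the occurrences of the atom the first has the largest discount, and the discounted [True]
    before it is no smaller. Without any occurrence the value is 0, which [e 0] never takes since it
    decreases strictly and stays nonnegative; injectivity of [e 0] then recovers the distance. *)
Lemma valueP r t x : val (value r) t = e 0 x <-> first pi r.*2.+1 t x.
Proof.
set p := r.*2.+1; have le1 i : e 0 i <= 1 by have [h _] := he 0; have /andP[] := h i.
pose f i := Num.min (e 0 i * val (FAtom p) (t + i))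
  (\big[Num.min/1]_(j < i) (e 0 j * 1)).
have fE : val (value r) t = sup (range f) by [].
have vf y : first pi p t y -> val (value r) t = e 0 y.
  move=> [py h].
  have bigE i : (e 0 i <= \big[Num.min/1]_(j < i) (e 0 j * 1)).
    by apply: le_bigmin => // j _; rewrite mulr1 e_le // ltnW.
  have fy : f y = e 0 y by rewrite /f val_atom py mulr1 (min_idPl (bigE y)).
  rewrite fE (sup_range_max (i0 := y)) // fy => i; rewrite /f ge_min val_atom.
  have [lt|le] := ltnP i y; first by rewrite (negPf (h _ lt)) mulr0 ltW ?e_gt0.
  apply/orP; left; apply: le_trans (e_le le).
  by case: (pi _ _); rewrite ?mulr1 ?mulr0 // ltW ?e_gt0.
split=> [vx|/vf //].
have [ex|nex] := pselect (exists y, pi (t + y)%N p).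
  have fy : first pi p t (ex_minn ex).
    case: ex_minnP => y py hy; split=> // j lj; apply/negP => /hy; lia.
  by move: (vf _ fy); rewrite vx => /e_inj ->.
have f0 i : f i = 0.
  rewrite /f val_atom (_ : pi _ _ = false) ?mulr0; last by apply/negP => h; apply: nex; exists i.
  by apply: min_idPl; apply: le_bigmin => // j _; rewrite mulr1 ltW ?e_gt0.
move: vx; rewrite fE (sup_range_max (i0 := 0%N)) => [|i]; last by rewrite !f0.
by rewrite f0 => /eqP; rewrite lt_eqF ?e_gt0.
Qed.

Lemma firstS p t x : first pi p t x.+1 <-> ~~ pi t p /\ first pi p t.+1 x.
Proof.
split=> [[h1 h2]|[h0 [h1 h2]]].
  split; first by have := h2 0%N isT; rewrite addn0.
  by split=> [|j lj]; rewrite addSnnS //; exact: h2.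
split=> [|[|j] lj]; rewrite ?addn0 // -addSnnS //; exact: h2.
Qed.

Lemma first0 p t x : first pi p t x -> pi t p = (x == 0%N).
Proof.
case: x => [[]|x [_ h]]; first by rewrite addn0.
by apply/negbTE; have := h 0%N isT; rewrite addn0.
Qed.

Lemma tr_first_not p m t : tr (first_not p m) t <-> ~ first pi p t m.
Proof.
elim: m t => [|m IH] t.
  rewrite [first_not _ _]/= tr_natom; split=> [/negP h [] |h].
    by rewrite addn0.
  by apply/negP => h'; apply: h; split; rewrite ?addn0.
rewrite [first_not _ _]/= tr_or tr_atom firstS; split=> [/orP[->|h] [] //|h].
  by move=> _; exact/IH.
rewrite -implyNb; apply/implyP => h'; apply/IH => h''; exact: h.
Qed.

Lemma tr_at_next a t t' : next_mark pi t t' -> tr (at_next a) t = tr a t'.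
Proof. by move=> h; rewrite /tr (val_at_next _ h). Qed.

Lemma tr_nat_next p t t' : next_mark pi t t' ->
  tr (FNot (at_next (FAtom p))) t = ~~ pi t' p.
Proof.
by move=> h; rewrite /tr -half_ltN -val_atom -(val_at_next _ h).
Qed.

(** By [valueP], comparing values compares distances. Looking one position later shortens a distance
    by one only if it is positive: for [Down] this is assumed at [t], for [Up] it is enforced by the
    disjunct [at_next (reg r)]. *)
Lemma bad_changeP o r t t' x : next_mark pi t t' -> first pi r.*2.+1 t x ->
  (o = Down -> (0 < x)%N) ->
  tr (bad_change o r) t <-> ~ first pi r.*2.+1 t' (change_val o x).
Proof.
move=> tt' fx x0; have vx := (proj2 (valueP _ _ _) fx).
case: o x0 => [_|_|/(_ erefl) x0] /=.
- rewrite tr_differ (val_at_next _ tt') vx -valueP.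
  by split=> [/eqP h e0|h]; [exact: h|apply/eqP => e0; exact: h].
- rewrite tr_or (tr_at_next _ tt') tr_atom tr_differ (val_at_next _ tt') vx.
  rewrite firstS -valueP /=; case: (pi t' _) => /=; first by split=> // _ [].
  by split=> [/eqP h [_ e0]|h]; [exact: h|apply/eqP => e0; apply: h].
- case: x x0 fx {vx} => // x _ /firstS[_ fx]; have vx := (proj2 (valueP _ _ _) fx).
  rewrite tr_differ (val_at_next _ tt') -valueP -vx /=.
  by split=> [/eqP h e0|h]; [exact: h|apply/eqP => e0; exact: h].
Qed.

(** * Computations as encodings of runs *)

Definition encodes B t (cf : nat * store) :=
  pi t cf.1.+1.*2 /\ forall r, (r < B)%N -> first pi r.*2.+1 t (cf.2 r).

Lemma bad_transP B j f t t' x : next_mark pi t t' ->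
  (forall r, (r < B)%N -> first pi r.*2.+1 t (x r)) ->
  (forall r, (r < B)%N -> f r = Down -> (0 < x r)%N) ->
  tr (bad_trans B j f) t <-> ~ encodes B t' (j, fun r => change_val (f r) (x r)).
Proof.
move=> tt' fx x0; rewrite tr_or (tr_nat_next _ tt') tr_ors has_map /encodes /=.
case: (pi t' _) => /=; last by split=> // _ [].
split=> [/hasP[r] | nf].
  rewrite mem_iota /= => rB /(bad_changeP tt' (fx r rB) (x0 r rB)) nf [_ h].
  exact/nf/h.
apply: contrapT => /negP/hasPn nb; apply: nf; split=> // r rB.
apply: contrapT => /(bad_changeP tt' (fx r rB) (x0 r rB)) b.
by have := nb r; rewrite mem_iota rB => /(_ isT); rewrite /= b.
Qed.

Lemma bad_stepP B P i x t t' : wf B P -> next_mark pi t t' ->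
  encodes B t (i, x) -> tr (bad_step B P i) t <-> ~ encodes B t' (step P (i, x)).
Proof.
move=> /and3P[_ _ wP] tt' [_ fx]; rewrite /bad_step /step.
case ei : (onth P i) => [[r|r j k]|].
- have -> : upd x r (x r).+1 = fun q => change_val (change_at r Up q) (x q).
    by apply/funext => q; rewrite /upd /change_at; case: eqP => // ->.
  by apply: bad_transP => // q _; rewrite /change_at; case: eqP.
- have rB : (r < B)%N.
    by have /and3P[] := all_onth wP ei.
  rewrite tr_or !tr_and tr_atom tr_natom (first0 (fx r rB)) /=.
  case: eqVneq => xr /=; rewrite ?orbF.
    exact: (bad_transP _ (f := fun=> Keep)).
  have -> : upd x r (x r).-1 = fun q => change_val (change_at r Down q) (x q).
    by apply/funext => q; rewrite /upd /change_at; case: eqP => // ->.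
  apply: bad_transP => // q _; rewrite /change_at; case: eqP => // -> _.
  by rewrite lt0n.
- exact: (bad_transP _ (f := fun=> Keep)).
Qed.

(** The clauses give the start, the local correctness of every mark and an accepting mark; atom 2 is
    [state 0] and atom 3 is [reg 1]. *)
Lemma rejectsP B P : ~~ tr (rejects B P) 0 <->
  [/\ pi 0 0%N /\ pi 0 2%N, forall r, (0 < r < B)%N -> pi 0 r.*2.+1,
      forall t i, (i <= B)%N -> pi t 0%N -> pi t i.+1.*2 ->
        ~~ tr (bad_step B P i) t /\ (pi t (size P).+1.*2 -> i = size P)
    & exists t, [/\ pi t 0%N, pi t (size P).+1.*2 & ~~ pi t 3%N]].
Proof.
have evE : tr (FEv (ors [seq bad_at B P i | i <- iota 0 B.+1])) 0 <->
    exists t i, [/\ (i <= B)%N, pi t 0%N, pi t i.+1.*2 &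
      tr (bad_step B P i) t || (i != size P) && pi t (size P).+1.*2].
  rewrite tr_ev; split=> [[t]|[t [i [iB m s b]]]].
    rewrite tr_ors has_map => /hasP[i]; rewrite mem_iota add0n ltnS /= => iB.
    rewrite /bad_at !tr_and !tr_atom tr_or => /and3P[m s b].
    exists t, i; split=> //; move: b; rewrite add0n.
    by case: eqP => _; rewrite ?tr_false ?tr_atom.
  exists t; rewrite tr_ors has_map; apply/hasP; exists i.
    by rewrite mem_iota add0n ltnS.
  rewrite /= /bad_at !tr_and !tr_atom tr_or add0n m s /=.
  by move: b; case: eqP => _; rewrite ?tr_false ?tr_atom.
have acE : tr (FNot (FEv (FAnd mark (FAnd (state (size P)) (FNot (reg 1)))))) 0 <->
    ~ exists t, [/\ pi t 0%N, pi t (size P).+1.*2 & ~~ pi t 3%N].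
  rewrite tr_nev => [|t].
    by split=> h [t]; move=> ht; apply: h; exists t; move: ht;
      rewrite !tr_and !tr_atom tr_natom add0n => /and3P.
  (* The eventuality is negated, so [tr_nev] asks that its body take only the values 0 and 1. *)
  rewrite !val_and !val_atom [Defs.val _ _ (FNot _) _]/=.
  case: (pi t 0%N); case: (pi t _.*2); case: (pi t _); rewrite /= ?subrr ?subr0;
    by rewrite /Num.min; do ?case: ifP; auto.
rewrite tr_ors /= orbF !negb_or !tr_natom !negbK tr_ors has_map -all_predC.
split=> [/and5P[p0 p2 /allP pr /negP ev /negP ac]|[[p0 p2] pr pb ac]].
- split=> //.
  + by move=> r rB; have := pr r; rewrite mem_iota /= tr_natom negbK; apply; lia.
  + move=> t i iB m s; split.
      by apply/negP => b; apply: ev; apply/evE; exists t, i; rewrite b.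
    move=> sP; apply/eqP/negPn/negP => ni; apply: ev; apply/evE; exists t, i.
    by rewrite ni sP orbT.
  + by apply: contrapT => /acE.
- apply/and5P; split=> //.
  + apply/allP => r; rewrite mem_iota /= tr_natom negbK => rB; apply: pr; lia.
  + apply/negP => /evE[t [i [iB m s]]]; have [/negPf-> h] := pb t i iB m s.
    by move=> /= /andP[/eqP ni /h].
  + by apply/negP => /acE.
Qed.

Lemma prev_mark t : pi 0 0%N -> (0 < t)%N -> pi t 0%N ->
  exists u, pi u 0%N /\ next_mark pi u t.
Proof.
move=> p0 t0 pt; have ex : exists u, (u < t)%N && pi u 0%N by exists 0%N; rewrite t0.
have bd u : (u < t)%N && pi u 0%N -> (u <= t)%N by case/andP => /ltnW.
case: (ex_maxnP ex bd) => u /andP[ut pu] hu; exists u; split=> //; split=> // v.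
move=> /andP[uv vt]; apply/negP => pv; have := hu v; rewrite vt pv => /(_ isT); lia.
Qed.

Lemma step_le B P cf : wf B P -> (cf.1 <= B)%N -> ((step P cf).1 <= B)%N.
Proof.
case: cf => i x /and3P[_ sP wP] /= iB; case ei : (onth P i) => [[r|r j k]|] //=.
  have : (i < size P)%N by rewrite -onthTE ei.
  by move=> /leq_trans; exact.
by have /and3P[] := all_onth wP ei; case: eqP.
Qed.

Lemma rejects_sound B P m : wf B P ->
  ~~ tr (FOr (rejects B P) (first_not 1 m)) 0 -> accepts P m.
Proof.
move=> wP; rewrite tr_or negb_or => /andP[/rejectsP[[p0 p2] pr pb [t [mt st rt]]]].
move=> /negP nf; have fm : first pi 1 0 m by apply: contrapT => /tr_first_not.
have pcB k : ((run P m k).1 <= B)%N.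
  by elim: k => // k IH; rewrite /run iterS; exact: step_le.
(* Strong induction on the position: the preceding mark encodes some [run P m k], and its step is
   not bad. *)
have enc u : pi u 0%N -> exists k, encodes B u (run P m k).
  elim/ltn_ind: u => u IH mu; have [->|u0] := posnP u.
    exists 0%N; split=> // -[//|r] rB; rewrite /= /init /upd /=.
    by split=> //; rewrite add0n; exact: pr.
  have [v [mv vu]] := prev_mark p0 u0 mu; have [lt _ _] := vu.
  have [k ek] := IH v lt mv; exists k.+1; rewrite /run iterS -/(run P m k).
  have [/negP nb _] := pb v _ (pcB k) mv (proj1 ek).
  move: ek nb; case: (run P m k) => i x ek nb.
  by apply: contrapT => /(bad_stepP wP vu ek).
have [k [sk xk]] := enc t mt; exists k.
(* The accepting mark also carries the state of the configuration it encodes; exclusivity of the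
   final state identifies the two. *)
have [_ /(_ st) ->] := pb t _ (pcB k) mt sk; split=> // x0.
have /and3P[B1 _ _] := wP.
by move: rt; rewrite (first0 (xk 1%N B1)) x0.
Qed.

End Semantics.

(** * From an accepting run to a computation *)

Section Completeness.
Variables (R : realType) (e : nat -> nat -> R).
Hypothesis he : forall k, discounting (e k).

Lemma rejects_complete B P m : wf B P -> accepts P m ->
  exists pi, ~~ tr e pi (FOr (rejects B P) (first_not 1 m)) 0.
Proof.
(* [L] exceeds every register content throughout the run, as nothing changes after time [k0]; so
   each register atom falls inside the block of its own configuration. *)
move=> wP [k0 [hk1 hk2]]; pose L := (m + k0).+1.
have xL j r : ((run P m j).2 r < L)%N.
  rewrite ltnS; have [le|/ltnW le] := leqP j k0.
    by apply: leq_trans (run_bound P m j r) _; rewrite leq_add2l.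
  by rewrite (run_halted hk1 le) run_bound.
(* The block of length [L] starting at [q * L] describes configuration [q]: its state everywhere,
   and the atom of a register at the offset equal to its content. *)
pose pi t a := (if a == 0 then L %| t else
  if odd a then t %% L == (run P m (t %/ L)).2 a./2
  else a./2 == (run P m (t %/ L)).1.+1)%N.
have piM t : pi t 0%N = (L %| t)%N by [].
have piS t i : pi t i.+1.*2 = (i == (run P m (t %/ L)%N).1).
  by rewrite /pi /= odd_double doubleK eqSS.
have piR t r : pi t r.*2.+1 = (t %% L == (run P m (t %/ L)).2 r)%N.
  by rewrite /pi /= odd_double /= uphalf_double.
have encL q : encodes pi B (q * L)%N (run P m q).
  split; first by rewrite piS mulnK.
  move=> r _; split=> [|j lj].
    by rewrite piR divnMDl // (divn_small (xL _ _)) addn0 modnMDl modn_small.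
  have jL := ltn_trans lj (xL _ _).
  rewrite piR divnMDl // (divn_small jL) addn0 modnMDl modn_small //.
  by rewrite neq_ltn lj.
have nxt q : next_mark pi (q * L) (q.+1 * L)%N.
  split; rewrite ?piM ?dvdn_mull //; first by rewrite ltn_mul2r /=.
  move=> u /andP[h1 h2]; rewrite piM; apply/negP => /dvdnP[v ev]; subst u.
  by move: h1 h2; rewrite !ltn_mul2r /= => ? ?; lia.
exists pi; rewrite tr_or negb_or; apply/andP; split; last first.
  apply/negP => /tr_first_not; apply; have /and3P[B1 _ _] := wP.
  by have [_ /(_ 0%N (ltnW B1))] := encL 0%N.
apply/(rejectsP he); split.
- by rewrite piM dvdn0 (piS 0 0)%N div0n.
- by move=> [|r] // _; rewrite piR mod0n div0n.
- move=> t i iB; rewrite piM => /dvdnP[q ->] ; rewrite !piS mulnK // => /eqP -> .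
  split; last by move=> /eqP.
  apply/negP; have := encL q; have := encL q.+1.
  rewrite /run iterS -/(run P m q); case: (run P m q) => j x e1 e0.
  by move=> /(bad_stepP he wP (nxt q) e0).
- exists (k0 * L)%N; rewrite piM dvdn_mull // piS mulnK // hk1 eqxx; split=> //.
  rewrite (piR _ 1%N) mulnK // modnMl; apply/negP => /eqP x0; exact: hk2.
Qed.

End Completeness.

(** * The diagonal argument *)

Theorem theorem5 (R : realType) (D : set (nat -> R)) :
  (exists eta, D eta) ->
  (forall eta, D eta -> discounting eta) ->
  forall e : nat -> (nat -> R), (forall k, D (e k)) ->
  ~ decidable_nat (validity_problem e).
Proof.
move=> _ hD e De [c hc]; have he k : discounting (e k) by exact/hD/De.
(* On the code of a formula [A], [d] asks the decider [c] about the disjunction of [A] with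
   [first_not 1] of that code, at threshold 1/2; 3 is the tag of [FOr]. *)
pose d := PComp c [:: prf_pair (prf_pair (prf_const 3)
   (prf_pair (PProj 0) (prf_first_not 1))) (prf_const (npair 1 2))].
have [B wB] := wf_exists (prog d).
(* The diagonal input: the code of the formula built from the machine of [d] itself. *)
pose m := enc_form (rejects B (prog d)).
pose phi := FOr (rejects B (prog d)) (first_not 1 m).
pose n := npair (enc_form phi) (npair 1 2).
have evd y : prf_eval c [:: n] y -> prf_eval d [:: m] y.
  apply: prf_comp1; apply: prf_pairP; last exact: prf_constP.
  apply: prf_pairP; first exact: prf_constP.
  by apply: prf_pairP; [exact: (@ev_proj 0 [:: m])|exact: prf_first_notP].
have validE : validity_problem e n <-> ~ accepts (prog d) m.
  split=> [[psi [p [q [/npair_inj[/enc_form_inj <-] /npair_inj[<- <-]]]]]|na].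
    move=> [_ [_ v]] /(rejects_complete he wB)[pi].
    by have := v pi; rewrite mul1r /tr => ->.
  exists phi, 1%N, 2%N; split=> //; split=> //; split=> // pi.
  rewrite mul1r; apply/negPn/negP => h; apply: na; exact: rejects_sound h.
(* If the instance is valid, [d] returns 1 and its machine accepts [m], so the instance is not
   valid; if it is not, [d] returns 0 and the machine does not accept, so it is. *)
have [hv|hv] := pselect (validity_problem e n).
  by apply: (validE.1 hv); apply/(accepts_prog (evd _ ((hc n).1 hv))).
by apply: (hv); apply/validE => /(accepts_prog (evd _ ((hc n).2 hv))).
Qed.
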